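(* Let $G$ be a finite group with identity $e$ and let $R=\bigoplus_{g\in G}R_g$ be a $G$-graded associative ring with identity which is a PI-ring and is graded-local. Assume that the order of $G$ is a unit in $R$ and that $R_gR_{g^{-1}}=0$ for every $g\in G\setminus\{e\}$. If $R_e$ is nil-good, then $R$ is graded nil-good.
   Context: A ring $R$ is $G$-graded if $R=\bigoplus_{g\in G}R_g$ with $R_g$ additive subgroups and $R_gR_h\subseteq R_{gh}$ for all $g,h\in G$; elements of $\bigcup_{g}R_g$ are called homogeneous. A right ideal $I$ is homogeneous if $I=\bigoplus_{g}(I\cap R_g)$. A graded-maximal right ideal is a proper homogeneous right ideal contained in no other proper homogeneous right ideal. $R$ is graded-local if it has a unique graded-maximal right ideal. A ring is nil-good if each of its elements is either nilpotent or a sum of a unit and a nilpotent. A $G$-graded ring is graded nil-good if each of its homogeneous elements is either nilpotent or a sum of a homogeneous unit and a homogeneous nilpotent. A ring $R$ is a PI-ring if there are a natural number $n$ and a polynomial $P$ in $n$ noncommuting variables with integer coefficients, at least one of whose monomials of highest degree has coefficient $1$, such that $P(r_1,\dots,r_n)=0$ for all $(r_1,\dots,r_n)\in R^n$. *)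

(* Defs.v *)
From mathcomp Require Export all_boot all_algebra all_fingroup.
From mathcomp Require Export boolp classical_sets.
From mathcomp Require Export finmap monalg.

Set Implicit Arguments.
Unset Strict Implicit.
Unset Printing Implicit Defensive.

Import GRing.Theory.

Local Open Scope classical_set_scope.
Local Open Scope ring_scope.

Section RingElements.
Variable R : pzRingType.
Implicit Types (S : set R) (x u : R).

(* For S a subring with the same identity as R, these are the units of S. *)
Definition unit_in S u : Prop :=
  S u /\ exists2 v, S v & u * v = 1 /\ v * u = 1.

Definition is_unit u : Prop := unit_in [set: R] u.

Definition nilpotent x : Prop := exists k : nat, x ^+ k = 0.

(* "The ring S is nil-good", for S a subring with the same identity as R. *)
Definition nil_good S : Prop :=
  forall x, S x ->
    nilpotent x \/
    exists u y, [/\ unit_in S u, S y, nilpotent y & x = u + y].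

Definition add_subgroup S : Prop :=
  S 0 /\ forall x y, S x -> S y -> S (x - y).

Definition right_ideal (I : set R) : Prop :=
  add_subgroup I /\ forall x r, I x -> I (x * r).

End RingElements.

Section PolynomialIdentity.
Variable R : pzRingType.

(* {malg int[{fmonom 'I_n}]} is the free algebra Z<X_1, ..., X_n>; this is its
   evaluation (mmap of monalg requires a nontrivial target ring). *)
Definition nc_eval (n : nat) (P : {malg int[{fmonom 'I_n}]}) (r : 'I_n -> R) :
    R :=
  \sum_(w <- msupp P) (P@_w)%:~R * \prod_(i <- w) r i.

Definition PI_ring : Prop :=
  exists (n : nat) (P : {malg int[{fmonom 'I_n}]}),
    (exists w, [/\ w \in msupp P,
                   forall w', w' \in msupp P -> (fdeg w' <= fdeg w)%N
                 & P@_w = 1]) /\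
    (forall r : 'I_n -> R, nc_eval P r = 0).

End PolynomialIdentity.

Section Graded.
Variables (gT : finGroupType) (R : pzRingType).
Implicit Types (A : gT -> set R) (I J : set R).

Definition direct_sum (B : gT -> set R) (S : set R) : Prop :=
  (forall x, S x <->
     exists2 f : {ffun gT -> R}, (forall g, B g (f g)) & x = \sum_g f g) /\
  (forall f f' : {ffun gT -> R},
     (forall g, B g (f g)) -> (forall g, B g (f' g)) ->
     \sum_g f g = \sum_g f' g -> f = f').

Record grading A : Prop := Grading {
  grading_subgroup : forall g, add_subgroup (A g);
  grading_direct_sum : direct_sum A [set: R];
  grading_mul : forall g h x y, A g x -> A h y -> A (g * h)%g (x * y)
}.

Definition homogeneous A (x : R) : Prop := exists g, A g x.

Definition homogeneous_right_ideal A I : Prop :=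
  right_ideal I /\ direct_sum (fun g => I `&` A g) I.

Definition proper_homogeneous_right_ideal A I : Prop :=
  homogeneous_right_ideal A I /\ I <> [set: R].

Definition graded_maximal A I : Prop :=
  proper_homogeneous_right_ideal A I /\
  forall J, proper_homogeneous_right_ideal A J -> I `<=` J -> J = I.

Definition graded_local A : Prop := exists! I, graded_maximal A I.

Definition graded_nil_good A : Prop :=
  forall x, homogeneous A x ->
    nilpotent x \/
    exists u y, [/\ homogeneous A u, is_unit u, homogeneous A y, nilpotent y
                  & x = u + y].

(* R_e is a subring of R with the same identity, so that [nil_good (A 1%g)]
   is the nil-goodness of the ring R_e. *)
Lemma grading_one A : grading A -> A 1%g 1.
Proof.
case=> sub [dec uniq] mul; have [/(_ I)[f Af E] _] := dec 1.
have fix_hom h x : A h x -> x * f 1%g = x.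
  move=> Ax; pose d : {ffun gT -> R} := [ffun g => if g == h then x else 0].
  pose p : {ffun gT -> R} := [ffun g => x * f (h^-1 * g)%g].
  suff /ffunP/(_ h) : p = d by rewrite !ffunE eqxx mulVg.
  apply: uniq => [g|g|].
  - by rewrite ffunE -[g in A g](mulKVg h); apply: mul.
  - by rewrite ffunE; case: eqP => [->|_] //; case: (sub g).
  - have -> : \sum_g d g = x.
      rewrite (bigD1 h) //= ffunE eqxx big1 ?addr0 // => g /negPf ne.
      by rewrite ffunE ne.
    rewrite -[RHS]mulr1 E mulr_sumr (reindex_inj (mulgI h)) /=.
    by apply: eq_bigr => g _; rewrite ffunE mulKg.
have -> : 1 = f 1%g; last exact: Af.
rewrite -[RHS]mul1r [in RHS]E mulr_suml [LHS]E.
by apply: eq_bigr => g _; rewrite (fix_hom g).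
Qed.

End Graded.

(* Main.v *)
Require Import Defs.

(** Homogeneous elements of degree [e] are handled by the nil-goodness of [R_e],
    whose units and nilpotents are homogeneous units and nilpotents of [R].
    Every homogeneous element [x] of degree [g <> e] is nilpotent: if [n] is the
    order of [g], then [x ^+ n.-1] has degree [g ^+ n.-1], which is the inverse
    of [g], so that [x ^+ n] lies in the product of the components of degrees
    [g] and [g^-1], and this product vanishes. *)

Import GRing.Theory.

Local Open Scope classical_set_scope.
Local Open Scope ring_scope.

Lemma grading_exp (gT : finGroupType) (R : pzRingType) (A : gT -> set R) g x n :
  grading A -> A g x -> A (g ^+ n)%g (x ^+ n).
Proof.
move=> grA Ax; elim: n => [|n IHn]; first exact: grading_one.
by rewrite exprS expgS; apply: (grading_mul grA).
Qed.

(** The finiteness of the group enters here, through the order of [g]. *)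
Lemma homogeneous_nilpotent (gT : finGroupType) (R : pzRingType)
    (A : gT -> set R) g x :
  grading A -> (forall y z, A g y -> A g^-1%g z -> y * z = 0) ->
  A g x -> nilpotent x.
Proof.
move=> grA mul0 Ax; exists #[g]%g.
rewrite -(prednK (order_gt0 g)) exprS; apply: mul0 => //.
by rewrite invg_expg; apply: grading_exp.
Qed.

Theorem theorem3p3 (gT : finGroupType) (R : pzRingType) (A : gT -> set R)
    (grA : grading A)
    (piR : PI_ring R)
    (locA : graded_local A)
    (unit_card : is_unit (#|gT|%:R : R))
    (mul0A : forall g : gT, g <> 1%g ->
       forall x y : R, A g x -> A g^-1%g y -> x * y = 0)
    (ngA : nil_good (A 1%g)) :
  graded_nil_good A.
Proof.
move=> x [g Ax].
have [g1 | /eqP/mul0A mul0] := eqVneq g 1%g; last first.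
  by left; apply: homogeneous_nilpotent Ax.
rewrite {}g1 in Ax.
have [|[u [y [[Au [v _ uv1]] Ay nil_y ->]]]] := ngA _ Ax; first by left.
by right; exists u, y; split=> //; [exists 1%g | split=> //; exists v | exists 1%g].
Qed.
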